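(* Let $\mathcal{K}$ be a finite field, let $\mathbb{F}_r$ be the free group on $r$ generators, and let $\{\theta_k:\mathbb{F}_r\to \mathrm{Mat}_{n_k\times n_k}(\mathcal{K})\}_{k=1}^\infty$ be a convergent sequence of finite dimensional representations. Then there exist a separable, continuous $\mathcal{K}$-algebra $R$ and a representation $\theta:\mathbb{F}_r\to R$ such that $\theta$ is a limit of $\{\theta_k\}_{k=1}^\infty$.
   Context: A finite dimensional representation $\theta_k:\mathbb{F}_r\to \mathrm{Mat}_{n_k\times n_k}(\mathcal{K})$ is a homomorphism of $\mathbb{F}_r$ into the group of invertible $n_k\times n_k$ matrices over $\mathcal{K}$. It is extended linearly to the group algebra $\mathcal{K}\mathbb{F}_r$ and entrywise to matrices over $\mathcal{K}\mathbb{F}_r$, so that for $A\in\mathrm{Mat}_{n\times n}(\mathcal{K}\mathbb{F}_r)$ we have $\theta_k(A)\in \mathrm{Mat}_{n\times n}(\mathrm{Mat}_{n_k\times n_k}(\mathcal{K}))\cong\mathrm{Mat}_{n_kn\times n_kn}(\mathcal{K})$. Put $\mathrm{rk}^n_{n_k}(\theta_k(A))=\mathrm{Rank}(\theta_k(A))/n_k$. The sequence $\{\theta_k\}$ is convergent if $\lim_{k\to\infty}\mathrm{rk}^n_{n_k}(\theta_k(A))$ exists for all $n\ge1$ and all $A\in \mathrm{Mat}_{n\times n}(\mathcal{K}\mathbb{F}_r)$. A unital ring $R$ is von Neumann regular if for every $a\in R$ there is $x\in R$ with $axa=a$. A rank regular ring is a unital von Neumann regular ring $R$ with a rank function $\mathrm{rk}_R:R\to[0,1]$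 satisfying: $\mathrm{rk}_R(a)=0$ iff $a=0$; $\mathrm{rk}_R(1)=1$; $\mathrm{rk}_R(a+b)\le \mathrm{rk}_R(a)+\mathrm{rk}_R(b)$; $\mathrm{rk}_R(ab)\le \min(\mathrm{rk}_R(a),\mathrm{rk}_R(b))$; $\mathrm{rk}_R(e+f)=\mathrm{rk}_R(e)+\mathrm{rk}_R(f)$ for orthogonal idempotents $e,f$. A continuous $\mathcal{K}$-algebra is a $\mathcal{K}$-algebra that is a rank regular ring complete in the metric $d_R(a,b)=\mathrm{rk}_R(a-b)$; it is separable if it is separable as a metric space. For a rank regular ring $R$, $\mathrm{rk}^n_R$ denotes the unique matrix rank function on $\mathrm{Mat}_{n\times n}(R)$ extending $\mathrm{rk}_R$, with $\mathrm{rk}^n_R(\mathrm{Id})=n$ and $\mathrm{rk}^n_R\begin{pmatrix}A&0\\0&B\end{pmatrix}=\mathrm{rk}^k_R(A)+\mathrm{rk}^{n-k}_R(B)$ for $A\in\mathrm{Mat}_{k\times k}(R)$, $B\in\mathrm{Mat}_{(n-k)\times(n-k)}(R)$ (so $\frac1n\mathrm{rk}^n_R$ is a rank function on $\mathrm{Mat}_{n\times n}(R)$). A representation $\theta:\mathbb{F}_r\to R$ into a continuous $\mathcal{K}$-algebra is a homomorphism into the group of invertible elements of $R$ (extended linearly to $\mathcal{K}\mathbb{F}_r$ and entrywise to matrices). It is a limit of $\{\theta_k\}$ if $\lim_{k\to\infty}\mathrm{rk}^n_{n_k}(\theta_k(A))=\mathrm{rk}^n_R(\theta(A))$ for all $n\ge1$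 and $A\in\mathrm{Mat}_{n\times n}(\mathcal{K}\mathbb{F}_r)$. *)

(* Defs.v *)
From HB Require Import structures.
From mathcomp Require Import all_boot all_algebra.
From mathcomp Require Import finmap monalg.
From mathcomp Require Import boolp classical_sets functions cardinality filter.
From mathcomp Require Import reals topology normedtype sequences.

Set Implicit Arguments.
Unset Strict Implicit.
Unset Printing Implicit Defensive.

Import GRing.Theory Num.Theory.
Import numFieldNormedType.Exports.

Local Open Scope classical_set_scope.
Local Open Scope ring_scope.

(* The free group on r generators is realised by the reduced words in the     *)
(* letters (i, b), where (i, true) stands for the i-th generator and          *)
(* (i, false) for its inverse.                                                *)
Section FreeGroup.
Variable r : nat.

Definition letter : Type := 'I_r * bool.
Definition letter_inv (x : letter) : letter := (x.1, ~~ x.2).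

Definition reduced (w : seq letter) : bool :=
  sorted (fun x y => y != letter_inv x) w.

Definition push (x : letter) (w : seq letter) : seq letter :=
  if w is y :: w' then if y == letter_inv x then w' else x :: w else [:: x].

Record free_group := FreeGroup {
  fg_word :> seq letter;
  fg_reduced : reduced fg_word
}.

HB.instance Definition _ := [isSub for fg_word].
HB.instance Definition _ := [Choice of free_group by <:].

Lemma letter_invK : involutive letter_inv.
Proof. by case=> i b; rewrite /letter_inv /= negbK. Qed.

Lemma reduced_push x w : reduced w -> reduced (push x w).
Proof.
case: w => [|y w] //= yw; case: eqVneq => [_|nyx].
  exact: path_sorted yw.
by rewrite /= nyx.
Qed.

Lemma pushK x w : reduced w -> push (letter_inv x) (push x w) = w.
Proof.
case: w => [|y w] /=; first by rewrite letter_invK eqxx.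
case: eqVneq => [->|_ _]; last by rewrite /= letter_invK eqxx.
by case: w => [|z w] //= /andP[/negPf ->].
Qed.

Lemma pushVK x w : reduced w -> push x (push (letter_inv x) w) = w.
Proof. by move=> rw; rewrite -{1}[x]letter_invK pushK. Qed.

Lemma reduced_foldr u v : reduced v -> reduced (foldr push v u).
Proof. by move=> rv; elim: u => //= x u; apply: reduced_push. Qed.

Lemma push_id x w : reduced (x :: w) -> push x w = x :: w.
Proof. by case: w => //= y w /andP[/negPf ->]. Qed.

Lemma foldr_push_nil w : reduced w -> foldr push [::] w = w.
Proof.
elim: w => //= x w IHw xw; rewrite IHw; last exact: path_sorted xw.
exact: push_id.
Qed.

Lemma foldr_push_push x v w : reduced v -> reduced w ->
  foldr push w (push x v) = push x (foldr push w v).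
Proof.
case: v => [|y v] //= _ rw; case: eqVneq => [->|//].
by rewrite pushVK //; apply: reduced_foldr.
Qed.

Lemma foldr_pushA u v w : reduced v -> reduced w ->
  foldr push w (foldr push v u) = foldr push (foldr push w v) u.
Proof.
move=> rv rw; elim: u => //= x u IHu.
by rewrite foldr_push_push ?IHu //; apply: reduced_foldr.
Qed.

Definition word_inv (w : seq letter) : seq letter := rev (map letter_inv w).

Lemma word_invK : involutive word_inv.
Proof. by move=> w; rewrite /word_inv map_rev revK (mapK letter_invK). Qed.

Lemma reduced_inv w : reduced w -> reduced (word_inv w).
Proof.
rewrite /reduced /word_inv rev_sorted sorted_map.
apply: sub_sorted => x y; apply: contra => /eqP.
by rewrite letter_invK /= => ->.
Qed.

Lemma foldr_pushV w v : reduced v ->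
  foldr push (foldr push v w) (word_inv w) = v.
Proof.
elim: w v => // x w IHw v rv.
rewrite /word_inv map_cons rev_cons foldr_rcons /= pushK ?IHw //.
exact: reduced_foldr.
Qed.

Definition fg_one : free_group := @FreeGroup [::] isT.
Definition fg_mul (u v : free_group) : free_group :=
  FreeGroup (reduced_foldr u (fg_reduced v)).
Definition fg_inv (u : free_group) : free_group :=
  FreeGroup (reduced_inv (fg_reduced u)).

Lemma fg_mulA : associative fg_mul.
Proof. by move=> u v w; apply/val_inj; rewrite /= foldr_pushA ?fg_reduced. Qed.

Lemma fg_mul1 : left_id fg_one fg_mul.
Proof. by move=> u; apply/val_inj. Qed.

Lemma fg_mulr1 : right_id fg_one fg_mul.
Proof. by move=> u; apply/val_inj; rewrite /= foldr_push_nil ?fg_reduced. Qed.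

Lemma fg_mulV : left_inverse fg_one fg_inv fg_mul.
Proof.
move=> u; apply/val_inj; rewrite /=.
by have := @foldr_pushV u [::] isT; rewrite foldr_push_nil ?fg_reduced.
Qed.

Lemma fg_mulrV : right_inverse fg_one fg_inv fg_mul.
Proof.
move=> u; rewrite -(fg_mulV (fg_inv u)); congr fg_mul.
by apply/val_inj; rewrite /= word_invK.
Qed.

HB.instance Definition _ :=
  isGroup.Build free_group fg_mulA fg_mul1 fg_mulr1 fg_mulV fg_mulrV.

End FreeGroup.

(* The monoid algebras of monalg require a monoid without nontrivial units,   *)
(* so the convolution product is defined here on the underlying module        *)
(* {malg K[G]} of finitely supported functions.                               *)
Definition group_algebra (K : fieldType) (G : groupType) : Type := {malg K[G]}.

Section GroupAlgebra.
Variables (K : fieldType) (G : groupType).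
Local Notation KG := (group_algebra K G).

HB.instance Definition _ := GRing.Lmodule.copy KG {malg K[G]}.

Definition ga_one : KG := << 1 *g (1%g : G) >>.

Definition ga_mul (a b : KG) : KG :=
  \sum_(g <- msupp a) \sum_(h <- msupp b) << a@_g * b@_h *g (g * h)%g >>.

Local Open Scope fset_scope.

Lemma ga_mulw (d1 d2 : {fset G}) (a b : KG) :
  msupp a `<=` d1 -> msupp b `<=` d2 ->
  ga_mul a b = \sum_(g <- d1) \sum_(h <- d2) << a@_g * b@_h *g (g * h)%g >>.
Proof.
move=> le1 le2; rewrite /ga_mul (big_fset_incl _ le1) /=.
  apply/eq_bigr => g _; apply/big_fset_incl => // h _ /mcoeff_outdom ->.
  by rewrite mulr0 monalgU0.
move=> g _ /mcoeff_outdom ag.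
by rewrite big1 // => h _; rewrite ag mul0r monalgU0.
Qed.

Lemma ga_mulDl : left_distributive ga_mul +%R.
Proof.
move=> a b c.
rewrite (ga_mulw (fsubsetUl (msupp a) (msupp b)) (fsubset_refl _)).
rewrite (ga_mulw (fsubsetUr (msupp a) (msupp b)) (fsubset_refl _)).
rewrite (ga_mulw (msuppD_le _ _) (fsubset_refl _)).
rewrite -big_split /=; apply/eq_bigr => g _.
rewrite -big_split /=; apply/eq_bigr => h _.
by rewrite mcoeffD mulrDl monalgUD.
Qed.

Lemma ga_mulDr : right_distributive ga_mul +%R.
Proof.
move=> c a b.
rewrite (ga_mulw (fsubset_refl _) (fsubsetUl (msupp a) (msupp b))).
rewrite (ga_mulw (fsubset_refl _) (fsubsetUr (msupp a) (msupp b))).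
rewrite (ga_mulw (fsubset_refl _) (msuppD_le _ _)).
rewrite -big_split /=; apply/eq_bigr => g _.
rewrite -big_split /=; apply/eq_bigr => h _.
by rewrite mcoeffD mulrDr monalgUD.
Qed.

Lemma ga_mul0 : left_zero 0 ga_mul.
Proof. by move=> a; rewrite /ga_mul msupp0 big_seq_fset0. Qed.

Lemma ga_mulr0 : right_zero 0 ga_mul.
Proof.
by move=> a; rewrite /ga_mul big1 // => g _; rewrite msupp0 big_seq_fset0.
Qed.

Lemma ga_mulUU (c d : K) (g h : G) :
  ga_mul << c *g g >> << d *g h >> = << c * d *g (g * h)%g >>.
Proof. by rewrite (ga_mulw msuppU_le msuppU_le) !big_seq_fset1 !mcoeffUU. Qed.

Lemma ga_mul_suml I (s : seq I) (F : I -> KG) b :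
  ga_mul (\sum_(i <- s) F i) b = \sum_(i <- s) ga_mul (F i) b.
Proof.
exact: (big_morph (ga_mul^~ b) (fun _ _ => ga_mulDl _ _ _) (ga_mul0 _)).
Qed.

Lemma ga_mul_sumr I (s : seq I) (F : I -> KG) a :
  ga_mul a (\sum_(i <- s) F i) = \sum_(i <- s) ga_mul a (F i).
Proof.
exact: (big_morph (ga_mul a) (fun _ _ => ga_mulDr _ _ _) (ga_mulr0 _)).
Qed.

Lemma ga_mulEl a b :
  ga_mul a b = \sum_(g <- msupp a) ga_mul << a@_g *g g >> b.
Proof. by rewrite -ga_mul_suml -monalgE. Qed.

Lemma ga_mulEr a b :
  ga_mul a b = \sum_(g <- msupp b) ga_mul a << b@_g *g g >>.
Proof. by rewrite -ga_mul_sumr -monalgE. Qed.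

Lemma ga_mulA : associative ga_mul.
Proof.
move=> a b c; rewrite [LHS]ga_mulEl [ga_mul a b]ga_mulEl ga_mul_suml.
apply: eq_bigr => g _; rewrite [ga_mul b c]ga_mulEl [ga_mul _ b]ga_mulEr.
rewrite ga_mul_sumr ga_mul_suml; apply: eq_bigr => h _.
rewrite [ga_mul _ c]ga_mulEr ga_mul_sumr [RHS]ga_mulEr.
by apply: eq_bigr => k _; rewrite !ga_mulUU mulrA mulgA.
Qed.

Lemma ga_mul1 : left_id ga_one ga_mul.
Proof.
move=> a; rewrite ga_mulEr [RHS]monalgE.
by apply: eq_bigr => g _; rewrite ga_mulUU mul1r mul1g.
Qed.

Lemma ga_mulr1 : right_id ga_one ga_mul.
Proof.
move=> a; rewrite ga_mulEl [RHS]monalgE.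
by apply: eq_bigr => g _; rewrite ga_mulUU mulr1 mulg1.
Qed.

Lemma ga_one_neq0 : ga_one != 0.
Proof. by rewrite monalgU_eq0 oner_eq0. Qed.

HB.instance Definition _ := GRing.Zmodule_isNzRing.Build KG
  ga_mulA ga_mul1 ga_mulr1 ga_mulDl ga_mulDr ga_one_neq0.

Lemma ga_scaleU (c d : K) (g : G) :
  c *: (<< d *g g >> : KG) = << c * d *g g >>.
Proof. by apply/malgP => h; rewrite mcoeffZ !mcoeffU mulrnAr. Qed.

Lemma ga_mulZl (c : K) (a b : KG) : c *: ga_mul a b = ga_mul (c *: a) b.
Proof.
rewrite [a]monalgE [in LHS]ga_mul_suml !scaler_sumr ga_mul_suml.
apply: eq_bigr => g _; rewrite ga_mulEr scaler_sumr [RHS]ga_mulEr.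
by apply: eq_bigr => h _; rewrite ga_scaleU !ga_mulUU ga_scaleU mulrA.
Qed.

Lemma ga_mulZr (c : K) (a b : KG) : c *: ga_mul a b = ga_mul a (c *: b).
Proof.
rewrite [b]monalgE [in LHS]ga_mul_sumr !scaler_sumr ga_mul_sumr.
apply: eq_bigr => g _; rewrite ga_mulEl scaler_sumr [RHS]ga_mulEl.
by apply: eq_bigr => h _; rewrite ga_scaleU !ga_mulUU ga_scaleU mulrCA.
Qed.

HB.instance Definition _ := GRing.Lmodule_isLalgebra.Build K KG ga_mulZl.
HB.instance Definition _ := GRing.Lalgebra_isAlgebra.Build K KG ga_mulZr.

End GroupAlgebra.

Definition invertible (A : pzRingType) (a : A) : Prop :=
  exists b, a * b = 1 /\ b * a = 1.

Definition is_representation (G : groupType) (A : pzRingType) (theta : G -> A)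
    : Prop :=
  (forall g, invertible (theta g)) /\
  {morph theta : g h / (g * h)%g >-> g * h}.

Definition lin_ext (K : fieldType) (G : groupType) (V : lmodType K)
    (theta : G -> V) (a : group_algebra K G) : V :=
  \sum_(g <- msupp a) a@_g *: theta g.

Definition flatten_mx (K : fieldType) (n d : nat) (B : 'M['M[K]_d]_n)
    : 'M[K]_(\sum_(i < n) d) :=
  \mxblock_(i < n, j < n) B i j.

Definition fd_rank (R : realType) (K : fieldType) (G : groupType) (d n : nat)
    (theta : G -> 'M[K]_d) (A : 'M[group_algebra K G]_n) : R :=
  (\rank (flatten_mx (map_mx (lin_ext theta) A)))%:R / d%:R.

Definition convergent (R : realType) (K : fieldType) (G : groupType)
    (d : nat -> nat) (theta : forall k, G -> 'M[K]_(d k)) : Prop :=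
  forall n (A : 'M[group_algebra K G]_n), (0 < n)%N ->
    cvgn (fun k => fd_rank R (theta k) A).

Definition von_neumann_regular (A : pzRingType) : Prop :=
  forall a : A, exists x, a * x * a = a.

Record rank_function (R : realType) (A : pzRingType) (rk : A -> R) : Prop :=
  RankFunction {
    rank_itv : forall a, 0 <= rk a <= 1;
    rank_eq0 : forall a, rk a = 0 <-> a = 0;
    rank_1 : rk 1 = 1;
    rank_add : forall a b, rk (a + b) <= rk a + rk b;
    rank_mul : forall a b, rk (a * b) <= Num.min (rk a) (rk b);
    rank_idem : forall e f, e * e = e -> f * f = f -> e * f = 0 -> f * e = 0 ->
      rk (e + f) = rk e + rk f
  }.

Definition rank_complete (R : realType) (A : pzRingType) (rk : A -> R) : Prop :=
  forall u : nat -> A,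
    (forall e : R, 0 < e -> exists N, forall m n,
       (N <= m)%N -> (N <= n)%N -> rk (u m - u n) < e) ->
    exists l : A, forall e : R, 0 < e -> exists N, forall n,
       (N <= n)%N -> rk (u n - l) < e.

Definition rank_separable (R : realType) (A : pzRingType) (rk : A -> R)
    : Prop :=
  exists D : set A, countable D /\
    forall (a : A) (e : R), 0 < e -> exists2 b, D b & rk (a - b) < e.

Record continuous_algebra (R : realType) (K : fieldType) (A : algType K)
    (rk : A -> R) : Prop := ContinuousAlgebra {
  cont_regular : von_neumann_regular A;
  cont_rank : rank_function rk;
  cont_complete : rank_complete rk
}.

(* rkM n plays the role of rk^n: on a von Neumann regular ring with rank      *)
(* function rk, these conditions determine the whole family rkM uniquely.     *)
Record matrix_rank (R : realType) (A : pzRingType) (rk : A -> R)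
    (rkM : forall n, 'M[A]_n -> R) : Prop := MatrixRank {
  matrix_rank_ext : forall a : A, rkM 1%N a%:M = rk a;
  matrix_rank_id : forall n, rkM n 1%:M = n%:R;
  matrix_rank_block : forall k l (B : 'M[A]_k) (C : 'M[A]_l),
    rkM (k + l)%N (block_mx B 0 0 C) = rkM k B + rkM l C;
  matrix_rank_fun : forall n, (0 < n)%N ->
    rank_function (fun B : 'M[A]_n => rkM n B / n%:R)
}.

Definition is_limit (R : realType) (K : fieldType) (G : groupType)
    (d : nat -> nat) (theta_ : forall k, G -> 'M[K]_(d k))
    (A : algType K) (rk : A -> R) (theta : G -> A) : Prop :=
  exists2 rkM : forall n, 'M[A]_n -> R, matrix_rank rk rkM &
    forall n (B : 'M[group_algebra K G]_n), (0 < n)%N ->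
      (fun k => fd_rank R (theta_ k) B) @ \oo -->
        rkM n (map_mx (lin_ext theta) B).

(* Main.v *)
Require Import Defs.
From HB Require Import structures.
From mathcomp Require Import all_boot all_order all_algebra.
From mathcomp Require Import boolp classical_sets functions cardinality.
From mathcomp Require Import set_interval filter reals interval_inference.
From mathcomp Require Import topology normedtype sequences.
From mathcomp Require Import ring lra.

Set Implicit Arguments.
Unset Strict Implicit.
Unset Printing Implicit Defensive.

Import Order.TTheory GRing.Theory Num.Theory.
Import numFieldNormedType.Exports.

Local Open Scope classical_set_scope.
Local Open Scope ring_scope.
Local Open Scope quotient_scope.

(** The limit algebra lives inside a metric ultraproduct.  Fix a free
    ultrafilter U on the natural numbers.  On the product of the matrix
    algebras 'M[K]_(d k), the limit along U of the normalised ranks is a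
    pseudo-rank, and dividing by the elements of pseudo-rank 0 gives a
    K-algebra Q.  The class of the family (theta_ k g) is a homomorphism into
    the units of Q.  Since U refines the filter of cofinite sets, a limit that
    exists along the integers is also the limit along U, so the rank of a matrix
    over the group algebra, read in Q, is the limit of its finite dimensional
    ranks.

    All the rank axioms, for elements as for matrices, follow from four
    properties of a family of functions on square matrices: the values at 1 and
    at 0, monotonicity under products, and additivity on diagonal blocks
    (sylvester_rank).  These four pass to limits, to quotients and to subrings.
    Subadditivity and additivity on orthogonal idempotents are consequences,
    because B + C and diag(B, C) (or e + f and diag(e, f)) are multiples of each
    other up to zero padding (sylD, syl_idem).

    Q is regular, because inner inverses can be chosen coordinate by coordinate,
    and complete (ultraproduct_complete), but in general not separable.  It is
    therefore cut down: any countable subset of a continuous algebra over a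
    countable field lies in a separable continuous subalgebra
    (countable_subalgebra).  One takes the closure of the countable subalgebra
    generated by the subset and closed under a choice of inner inverses.  The
    point is that this closure is again regular: an inner inverse of a can be
    corrected into one of b by a perturbation of rank at most 3 rk (b - a)
    (correct_qinv_dist), so inner inverses of a fast approximating sequence can
    be chosen to form a Cauchy sequence. *)

(** * Sylvester rank families *)

(** A rank for square matrices of all sizes, without faithfulness.  The axioms
    mention neither sums nor idempotents, which makes them easy to transport
    along limits, quotients and subrings. *)
Record sylvester_rank (R : realType) (A : pzRingType)
    (rho : forall n, 'M[A]_n -> R) : Prop := SylvesterRank {
  syl1 : forall n, rho n 1%:M = n%:R;
  syl0 : forall n, rho n 0 = 0;
  sylM : forall n (B C : 'M[A]_n),
    rho n (B *m C) <= Num.min (rho n B) (rho n C);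
  syl_block : forall k l (B : 'M[A]_k) (C : 'M[A]_l),
    rho (k + l)%N (block_mx B 0 0 C) = rho k B + rho l C
}.

Section SylvesterTheory.
Variables (R : realType) (A : pzRingType) (rho : forall n, 'M[A]_n -> R).
Hypothesis rhoP : sylvester_rank rho.
Implicit Type n : nat.

Lemma syl_mulr n (B C : 'M[A]_n) : rho (B *m C) <= rho B.
Proof. by apply: le_trans (sylM rhoP B C) _; rewrite ge_min lexx. Qed.

Lemma syl_mull n (B C : 'M[A]_n) : rho (B *m C) <= rho C.
Proof. by apply: le_trans (sylM rhoP B C) _; rewrite ge_min lexx orbT. Qed.

Lemma syl_ge0 n (B : 'M[A]_n) : 0 <= rho B.
Proof. by rewrite -(syl0 rhoP n) -(mulmx0 _ B) syl_mulr. Qed.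

Lemma syl_le n (B : 'M[A]_n) : rho B <= n%:R.
Proof. by rewrite -(syl1 rhoP n) -{1}[B]mulmx1 syl_mull. Qed.

(** B + C, padded with zeros, is [1 1] diag(B, C) [1 1]^T. *)
Lemma sylD n (B C : 'M[A]_n) : rho (B + C) <= rho B + rho C.
Proof.
have -> : rho (B + C) = rho (block_mx (B + C) 0 0 (0 : 'M_n)).
  by rewrite (syl_block rhoP) (syl0 rhoP) addr0.
rewrite -(syl_block rhoP).
have -> : block_mx (B + C) 0 0 0 =
    block_mx 1%:M 1%:M 0 (0 : 'M_n) *m block_mx B 0 0 C *m
      block_mx 1%:M 0 1%:M (0 : 'M_n).
  by rewrite !mulmx_block !(mulmx1, mul1mx, mulmx0, mul0mx, addr0, add0r).
exact: le_trans (syl_mulr _ _) (syl_mull _ _).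
Qed.

Lemma sylN n (B : 'M[A]_n) : rho (- B) = rho B.
Proof.
have le (C : 'M[A]_n) : rho (- C) <= rho C.
  by rewrite -[C in - C]mul1mx -mulNmx syl_mull.
by apply/le_anti; rewrite le -{1}[B]opprK le.
Qed.

Lemma syl_sum n I (s : seq I) (P : pred I) (F : I -> 'M[A]_n) :
  rho (\sum_(i <- s | P i) F i) <= \sum_(i <- s | P i) rho (F i).
Proof.
elim/big_ind2: _ => [|x x' y y' lex ley|//]; first by rewrite (syl0 rhoP).
exact: le_trans (sylD _ _) (lerD lex ley).
Qed.

Lemma mulmx_delta_delta n (B : 'M[A]_n) i j k l :
  delta_mx i j *m B *m delta_mx k l = B j k *: delta_mx i l :> 'M_n.
Proof.
apply/matrixP => p q; rewrite mxE (bigD1 k) //= big1 ?addr0; last first.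
  by move=> h nhk; rewrite [X in _ * X]mxE (negPf nhk) mulr0.
rewrite mxE (bigD1 j) //= big1 ?addr0; last first.
  by move=> h nhk; rewrite mxE (negPf nhk) andbF mul0r.
rewrite !mxE !eqxx !(andbT, andTb).
by do 2!case: eqP => _; rewrite !(mul0r, mulr0, mul1r, mulr1).
Qed.

(** Together with syl_delta and mulmx_delta_delta, compares the rank of a matrix
    with the ranks of its entries: syl_entry gives faithfulness on matrices from
    faithfulness on elements, and syl_le_entries makes the rank continuous in
    the entries. *)
Lemma syl_corner n (a : A) :
  rho (a *: delta_mx 0 0 : 'M[A]_n.+1) = rho (a%:M : 'M_1).
Proof.
have <- : block_mx (a%:M : 'M_1) 0 0 (0 : 'M_n) = a *: delta_mx 0 0 :> 'M_n.+1.
  apply/matrixP => i j; rewrite -(@splitK 1 n i) -(@splitK 1 n j).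
  case: (@fintype.split 1 n i) => i'; case: (@fintype.split 1 n j) => j' /=;
    rewrite !(@block_mxEul _ 1 n 1 n, @block_mxEur _ 1 n 1 n,
              @block_mxEdl _ 1 n 1 n, @block_mxEdr _ 1 n 1 n) !mxE.
  - by rewrite !ord1 mulr1.
  - by rewrite -!val_eqE /= andbF mulr0.
  - by rewrite mulr0.
  - by rewrite mulr0.
by rewrite [LHS](syl_block rhoP (a%:M : 'M_1) (0 : 'M_n)) (syl0 rhoP) addr0.
Qed.

Lemma syl_delta n (a : A) (i j : 'I_n) :
  rho (a *: delta_mx i j : 'M[A]_n) = rho (a%:M : 'M_1).
Proof.
case: n i j => [[]|n] i j //.
rewrite -(syl_corner n).
have delta_le (i1 j1 i2 j2 : 'I_n.+1) :
      rho (a *: delta_mx i1 j1 : 'M[A]_n.+1) <=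
      rho (a *: delta_mx i2 j2 : 'M[A]_n.+1).
  have -> : a *: delta_mx i1 j1 =
     delta_mx i1 i2 *m (a *: delta_mx i2 j2) *m delta_mx j2 j1 :> 'M[A]_n.+1.
    by rewrite mulmx_delta_delta !mxE !eqxx mulr1.
  exact: le_trans (syl_mulr _ _) (syl_mull _ _).
by apply/le_anti; rewrite !delta_le.
Qed.

Lemma syl_entry n (B : 'M[A]_n) i j : rho ((B i j)%:M : 'M_1) <= rho B.
Proof.
rewrite -(syl_delta (B i j) i j).
rewrite -mulmx_delta_delta.
exact: le_trans (syl_mulr _ _) (syl_mull _ _).
Qed.

Lemma syl_le_entries n (B : 'M[A]_n) :
  rho B <= \sum_i \sum_j rho ((B i j)%:M : 'M_1).
Proof.
rewrite [leLHS](_ : _ = rho (\sum_i \sum_j B i j *: delta_mx i j)); last first.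
  by congr rho; exact: matrix_sum_delta.
apply: le_trans (syl_sum _ _ _) _; apply: ler_sum => i _.
by apply: le_trans (syl_sum _ _ _) _; apply: ler_sum => j _; rewrite syl_delta.
Qed.

(** For orthogonal idempotents, diag(e, f) is the product of the column with
    blocks e and f, of e + f, and of the row with blocks e and f. *)
Lemma syl_idem n (e f : 'M[A]_n) :
    e *m e = e -> f *m f = f -> e *m f = 0 -> f *m e = 0 ->
  rho (e + f) = rho e + rho f.
Proof.
move=> ee ff ef fe; apply/le_anti; rewrite sylD /=.
have -> : rho (e + f) = rho (block_mx (e + f) 0 0 (0 : 'M_n)).
  by rewrite (syl_block rhoP) (syl0 rhoP) addr0.
rewrite -(syl_block rhoP).
have -> : block_mx e 0 0 f =
    block_mx e 0 f (0 : 'M_n) *m block_mx (e + f) 0 0 (0 : 'M_n) *m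
      block_mx e f 0 (0 : 'M_n).
  rewrite !mulmx_block !(mulmx0, mul0mx, addr0, add0r).
  by rewrite !mulmxDr ee ff ef fe !(addr0, add0r) ee ef fe ff.
exact: le_trans (syl_mulr _ _) (syl_mull _ _).
Qed.

Hypothesis faithful : forall a, rho (a%:M : 'M_1) = 0 -> a = 0.

Lemma syl_rank_function n : (0 < n)%N ->
  rank_function (fun B : 'M[A]_n => rho B / n%:R).
Proof.
move=> n_gt0; have n0 : (0 : R) < n%:R by rewrite ltr0n.
split=> [B|B|||B C|e f ee ff ef fe].
- by rewrite divr_ge0 ?syl_ge0 ?ler0n //= ler_pdivrMr ?mul1r ?syl_le.
- split=> [/eqP|->]; last by rewrite (syl0 rhoP) mul0r.
  rewrite mulf_eq0 invr_eq0 (gt_eqF n0) orbF => /eqP rB.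
  apply/matrixP => i j; rewrite mxE; apply: faithful.
  by apply/le_anti; rewrite syl_ge0 andbT -rB syl_entry.
- by rewrite (syl1 rhoP) divff ?gt_eqF.
- by move=> B C; rewrite -mulrDl ler_pM2r ?invr_gt0 ?sylD.
- by rewrite le_min !ler_pM2r ?invr_gt0 ?syl_mulr ?syl_mull.
- by rewrite syl_idem ?mulrDl.
Qed.

Lemma scalar_rank_function :
  rank_function (fun a => rho (a%:M : 'M_1)).
Proof.
have [itv0 eq0 r1 rD rM ridem] := @syl_rank_function 1 isT.
split=> [a|a|||a b|e f ee ff ef fe].
- by have := itv0 a%:M; rewrite divr1.
- by split=> [/faithful|->] //; rewrite raddf0 (syl0 rhoP).
- by rewrite (syl1 rhoP).
- by move=> a b; rewrite raddfD sylD.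
- by rewrite scalar_mxM (sylM rhoP).
- by rewrite raddfD syl_idem -?scalar_mxM ?ee ?ff ?ef ?fe ?raddf0.
Qed.

Lemma syl_matrix_rank :
  matrix_rank (fun a => rho (a%:M : 'M_1)) rho.
Proof.
split=> //; first exact: (syl1 rhoP).
  exact: (syl_block rhoP).
exact: syl_rank_function.
Qed.

End SylvesterTheory.

(** * The normalised rank of matrices over a matrix algebra *)

Section FlattenRank.
Variables (R : realType) (K : fieldType) (d : nat).
Hypothesis d_gt0 : (0 < d)%N.

Lemma flatten_mxE n (B : 'M['M[K]_d]_n) i j (a b : 'I_d) :
  flatten_mx B (@tagnat.Rank n (fun=> d) i a) (@tagnat.Rank n (fun=> d) j b) =
  B i j a b.
Proof.
have := mxblockK (fun i j => B i j) i j.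
by move/matrixP/(_ a b); rewrite 2!mxE.
Qed.

Lemma flatten_mx1 n : flatten_mx (1%:M : 'M['M[K]_d]_n) = 1%:M.
Proof.
apply/matrixP => x y; rewrite -(tagnat.sig2K x) -(tagnat.sig2K y) flatten_mxE.
rewrite [RHS]mxE -val_eqE tagnat.eq_Rank mxE val_eqE.
by case: eqP => _; rewrite mxE.
Qed.

Lemma flatten_mxM n (B C : 'M['M[K]_d]_n) :
  flatten_mx (B *m C) = flatten_mx B *m flatten_mx C.
Proof.
rewrite /flatten_mx mul_mxblock; apply: eq_mxblock => i j.
by rewrite mxE.
Qed.

Lemma rank_mxsub m n (f : 'I_m -> 'I_n) (A : 'M[K]_n) :
  (\rank (mxsub f f A) <= \rank A)%N.
Proof.
have -> : mxsub f f A = rowsub f 1%:M *m A *m colsub f 1%:M.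
  by rewrite mulmx_colsub mulmx1 mul_rowsub_mx mul1mx -mxsub_comp.
exact: leq_trans (mxrankM_maxl _ _) (mxrankM_maxr _ _).
Qed.

Lemma sig2_Rank n (i : 'I_n) (a : 'I_d) :
  tagnat.sig2 (@tagnat.Rank n (fun=> d) i a) = a :> 'I_d.
Proof. by rewrite tagnat.Rank2K; apply: val_inj. Qed.

(** Flattening a block diagonal matrix gives the block diagonal matrix of the
    flattenings up to a bijection f between the two index types, with inverse g;
    as a submatrix has smaller rank, one inequality comes from f and the other
    from g. *)
Lemma rank_flatten_block k l (B : 'M['M[K]_d]_k) (C : 'M['M[K]_d]_l) :
  \rank (flatten_mx (block_mx B 0 0 C)) =
  (\rank (flatten_mx B) + \rank (flatten_mx C))%N.
Proof.
rewrite -rank_diag_block_mx.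
pose f (x : 'I_(\sum_(i < k) d + \sum_(i < l) d)) : 'I_(\sum_(i < k + l) d) :=
  match fintype.split x with
  | inl y => @tagnat.Rank (k + l) (fun=> d)
               (lshift l (tagnat.sig1 y)) (tagnat.sig2 y)
  | inr y => @tagnat.Rank (k + l) (fun=> d)
               (rshift k (tagnat.sig1 y)) (tagnat.sig2 y)
  end.
pose g (x : 'I_(\sum_(i < k + l) d)) : 'I_(\sum_(i < k) d + \sum_(i < l) d) :=
  match fintype.split (tagnat.sig1 x) with
  | inl y => lshift _ (@tagnat.Rank k (fun=> d) y (tagnat.sig2 x))
  | inr y => rshift _ (@tagnat.Rank l (fun=> d) y (tagnat.sig2 x))
  end.
apply/anti_leq/andP; split.
  suff -> : flatten_mx (block_mx B 0 0 C) =
     mxsub g g (block_mx (flatten_mx B) 0 0 (flatten_mx C)).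
    exact: rank_mxsub.
  have gl y a : g (@tagnat.Rank (k + l) (fun=> d) (lshift l y) a) =
      lshift _ (@tagnat.Rank k (fun=> d) y a).
    by rewrite /g tagnat.Rank1K sig2_Rank (unsplitK (inl y)).
  have gr y a : g (@tagnat.Rank (k + l) (fun=> d) (rshift k y) a) =
      rshift _ (@tagnat.Rank l (fun=> d) y a).
    by rewrite /g tagnat.Rank1K sig2_Rank (unsplitK (inr y)).
  apply/matrixP => x y; rewrite -(tagnat.sig2K x) -(tagnat.sig2K y).
  move: (tagnat.sig1 x) (tagnat.sig2 x) (tagnat.sig1 y) (tagnat.sig2 y) => /=.
  move=> i a j b; rewrite flatten_mxE [RHS]mxE -[i]splitK -[j]splitK.
  by case: (fintype.split i) => i'; case: (fintype.split j) => j' /=;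
    rewrite !(gl, gr, block_mxEul, block_mxEur, block_mxEdl, block_mxEdr);
    rewrite ?flatten_mxE // !mxE.
suff -> : block_mx (flatten_mx B) 0 0 (flatten_mx C) =
     mxsub f f (flatten_mx (block_mx B 0 0 C)).
  exact: rank_mxsub.
apply/matrixP => i j; rewrite [RHS]mxE -[i]splitK -[j]splitK.
case: (fintype.split i) => x; case: (fintype.split j) => y /=;
  rewrite !(block_mxEul, block_mxEur, block_mxEdl, block_mxEdr) /f
    ?(unsplitK (inl x)) ?(unsplitK (inr x)) ?(unsplitK (inl y))
    ?(unsplitK (inr y)) flatten_mxE;
  rewrite !(block_mxEul, block_mxEur, block_mxEdl, block_mxEdr).
- by rewrite -flatten_mxE !tagnat.sig2K.
- by rewrite !mxE.
- by rewrite !mxE.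
- by rewrite -flatten_mxE !tagnat.sig2K.
Qed.

Lemma matrix_sylvester : sylvester_rank (A := 'M[K]_d)
  (fun n (B : 'M['M[K]_d]_n) => (\rank (flatten_mx B))%:R / d%:R : R).
Proof.
have d0 : 0 < d%:R :> R by rewrite ltr0n.
split=> [n|n|n B C|k l B C].
- by rewrite flatten_mx1 mxrank1 sum_nat_const card_ord natrM mulfK ?gt_eqF.
- by rewrite /flatten_mx (_ : (\mxblock_(_, _) _) = 0) ?mxrank0 ?mul0r //;
    apply/matrixP => x y; rewrite !mxE.
- rewrite le_min !ler_pM2r ?invr_gt0 // !ler_nat flatten_mxM.
  by rewrite mxrankM_maxl mxrankM_maxr.
- by rewrite rank_flatten_block natrD mulrDl.
Qed.

Lemma matrix_regular : von_neumann_regular 'M[K]_d.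
Proof. by move=> a; exists (pinvmx a); apply: mulmxKpV. Qed.

End FlattenRank.

(** * The rank metric *)

Section RankMetric.
Variables (R : realType) (A : pzRingType) (rk : A -> R).
Hypothesis rkP : rank_function rk.

Lemma rank_ge0 a : 0 <= rk a.
Proof. by case/andP: (rank_itv rkP a). Qed.

Lemma rank_zero : rk 0 = 0.
Proof. exact: (rank_eq0 rkP 0).2. Qed.

Lemma rank_mulr a b : rk (a * b) <= rk a.
Proof. by apply: le_trans (rank_mul rkP a b) _; rewrite ge_min lexx. Qed.

Lemma rank_mull a b : rk (a * b) <= rk b.
Proof. by apply: le_trans (rank_mul rkP a b) _; rewrite ge_min lexx orbT. Qed.

Lemma rank_opp a : rk (- a) = rk a.
Proof.
have le b : rk (- b) <= rk b by rewrite -mulN1r rank_mull.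
by apply/le_anti; rewrite le -{1}[a]opprK le.
Qed.

Lemma rank_distC a b : rk (a - b) = rk (b - a).
Proof. by rewrite -rank_opp opprB. Qed.

Lemma rank_triangle c a b : rk (a - b) <= rk (a - c) + rk (c - b).
Proof.
by rewrite (_ : a - b = (a - c) + (c - b)) ?rank_add // addrA subrK.
Qed.

Lemma rank_distD a b a' b' :
  rk (a + b - (a' + b')) <= rk (a - a') + rk (b - b').
Proof. by rewrite opprD addrACA rank_add. Qed.

Lemma rank_distM a b a' b' :
  rk (a * b - a' * b') <= rk (a - a') + rk (b - b').
Proof.
have -> : a * b - a' * b' = (a - a') * b + a' * (b - b').
  by rewrite mulrBl mulrBr addrA subrK.
by apply: le_trans (rank_add rkP _ _) _; rewrite lerD ?rank_mulr ?rank_mull.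
Qed.

Lemma rank_small_eq a b : (forall e, 0 < e -> rk (a - b) < e) -> a = b.
Proof.
move=> small; apply/subr0_eq/(rank_eq0 rkP)/le_anti; rewrite rank_ge0 andbT.
by apply/ler_addgt0Pl => e /small /ltW; rewrite addr0.
Qed.

Lemma rank_sum I (s : seq I) (P : pred I) (F : I -> A) :
  rk (\sum_(i <- s | P i) F i) <= \sum_(i <- s | P i) rk (F i).
Proof.
elim/big_ind2: _ => [|x x' y y' lex ley|//]; first by rewrite rank_zero.
exact: le_trans (rank_add rkP _ _) (lerD lex ley).
Qed.

Lemma sum_geometric_tail i n : (i <= n)%N ->
  \sum_(i <= j < n) 2^-1 ^+ j <= 2 * 2^-1 ^+ i :> R.
Proof.
move=> le_in.
suff -> : \sum_(i <= j < n) 2^-1 ^+ j = 2 * 2^-1 ^+ i - 2 * 2^-1 ^+ n :> R.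
  by rewrite gerBl mulr_ge0 // exprn_ge0 // invr_ge0.
elim: n le_in => [|n IH].
  by rewrite leqn0 => /eqP->; rewrite big_geq // subrr.
rewrite leq_eqVlt => /predU1P[->|]; first by rewrite big_geq // subrr.
by rewrite ltnS => le_in; rewrite big_nat_recr //= IH // exprS; field.
Qed.

Lemma geometric_lt (e : R) : 0 < e ->
  exists N, forall n, (N <= n)%N -> 2^-1 ^+ n < e.
Proof.
move=> e0; have [N _ NP] := near_infty_natSinv_expn_lt (PosNum e0).
by exists N => n /NP; rewrite /= div1r exprVn.
Qed.

Lemma fast_cauchy_dist (w : nat -> A) :
    (forall j, rk (w j.+1 - w j) <= 2^-1 ^+ j) ->
  forall i n, (i <= n)%N -> rk (w n - w i) <= 2 * 2^-1 ^+ i.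
Proof.
move=> wP i n le_in; rewrite -telescope_sumr //.
apply: le_trans (rank_sum _ _ _) (le_trans _ (sum_geometric_tail le_in)).
exact: ler_sum.
Qed.

Lemma fast_cauchy_limit (w : nat -> A) : rank_complete rk ->
    (forall j, rk (w j.+1 - w j) <= 2^-1 ^+ j) ->
  exists l, forall e, 0 < e ->
    exists N, forall n, (N <= n)%N -> rk (w n - l) < e.
Proof.
move=> complete wP; apply: complete => e e0.
have [i /(_ i (leqnn i)) ilt] := geometric_lt (divr_gt0 e0 (ltr0n _ 4)).
exists i => m n le_im le_in; apply: le_lt_trans (rank_triangle (w i) _ _) _.
rewrite [X in _ + X]rank_distC.
have := fast_cauchy_dist wP le_im; have := fast_cauchy_dist wP le_in; lra.
Qed.

(** A Cauchy sequence converges as soon as a subsequence does, and it has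
    subsequences whose successive distances decay geometrically. *)
Lemma complete_of_fast_limits :
    (forall w : nat -> A, (forall j, rk (w j.+1 - w j) < 2^-1 ^+ j) ->
      exists l, forall i, rk (w i - l) <= 2 * 2^-1 ^+ i) ->
  rank_complete rk.
Proof.
move=> fast u cauchy.
have half_gt0 j : 0 < 2^-1 ^+ j :> R by rewrite exprn_gt0 // invr_gt0.
have [N NP] := choice (fun j => cauchy _ (half_gt0 j)).
pose m j := (\max_(i < j.+1) N i)%N.
have le_Nm j i : (i <= j)%N -> (N i <= m j)%N.
  by move=> le_ij; apply: (leq_bigmax (Ordinal (le_ij : (i < j.+1)%N))).
have [l lP] : exists l, forall i, rk (u (m i) - l) <= 2 * 2^-1 ^+ i.
  by apply: (fast (u \o m)) => j; apply: NP; apply: le_Nm.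
exists l => e e0.
have [i /(_ i (leqnn i)) ilt] := geometric_lt (divr_gt0 e0 (ltr0n _ 3)).
exists (N i) => n le_Nn.
apply: le_lt_trans (rank_triangle (u (m i)) _ _) _.
have := NP i _ _ le_Nn (le_Nm i i (leqnn i)); have := lP i; lra.
Qed.

End RankMetric.

(** * Separable continuous subalgebras *)

Section CountableSubalgebra.
Variables (R : realType) (K : countFieldType) (A : algType K) (rk : A -> R).
Hypothesis contA : continuous_algebra rk.
Variables (T : countType) (gen : T -> A).

Let rkP : rank_function rk := cont_rank contA.
Let qinv : A -> A := projT1 (choice (cont_regular contA)).
Let qinvP a : a * qinv a * a = a := projT2 (choice (cont_regular contA)) a.

(** Terms built from the generators and the scalars by addition, multiplication
    and qinv, encoded as generic trees because those form a countable type.  The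
    label of a unary node is ignored, and the remaining shapes denote 0. *)
Fixpoint eval_term (t : GenTree.tree (T + K)) : A :=
  match t with
  | GenTree.Leaf (inl x) => gen x
  | GenTree.Leaf (inr c) => c%:A
  | GenTree.Node 0 [:: s; t] => eval_term s + eval_term t
  | GenTree.Node 1 [:: s; t] => eval_term s * eval_term t
  | GenTree.Node _ [:: s] => qinv (eval_term s)
  | GenTree.Node _ _ => 0
  end.

Let S := range eval_term.

Lemma term_gen x : S (gen x). Proof. by exists (GenTree.Leaf (inl x)). Qed.

Lemma term_scalar c : S c%:A. Proof. by exists (GenTree.Leaf (inr c)). Qed.

Lemma term_one : S 1. Proof. by rewrite -[1]scale1r; apply: term_scalar. Qed.

Lemma term_add a b : S a -> S b -> S (a + b).
Proof. by move=> [s _ <-] [t _ <-]; exists (GenTree.Node 0 [:: s; t]). Qed.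

Lemma term_mul a b : S a -> S b -> S (a * b).
Proof. by move=> [s _ <-] [t _ <-]; exists (GenTree.Node 1 [:: s; t]). Qed.

Lemma term_qinv a : S a -> S (qinv a).
Proof. by move=> [s _ <-]; exists (GenTree.Node 0 [:: s]). Qed.

Lemma term_sub a b : S a -> S b -> S (a - b).
Proof.
move=> Sa Sb; apply: term_add Sa _; rewrite -mulN1r.
by apply: term_mul Sb; rewrite -scaleN1r; apply: term_scalar.
Qed.

Lemma term_countable : countable S.
Proof. exact: sub_countable (card_image_le _ _) (countableP _). Qed.

Definition term_closure : pred A :=
  fun a => `[< forall e, 0 < e -> exists2 b, S b & rk (a - b) < e >].

Lemma term_closureP a :
  reflect (forall e, 0 < e -> exists2 b, S b & rk (a - b) < e)
    (a \in term_closure).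
Proof. exact: asboolP. Qed.

Lemma term_closure_term a : S a -> a \in term_closure.
Proof.
move=> Sa; apply/term_closureP => e e0; exists a => //.
by rewrite subrr (rank_zero rkP).
Qed.

Lemma term_closure_subalg : GRing.subalg_closed term_closure.
Proof.
split=> [|c a b /term_closureP aP /term_closureP bP|
         a b /term_closureP aP /term_closureP bP].
- exact: term_closure_term term_one.
- apply/term_closureP => e e0; have e20 : 0 < e / 2 by rewrite divr_gt0.
  have [a' Sa' aa'] := aP _ e20; have [b' Sb' bb'] := bP _ e20.
  exists (c%:A * a' + b').
    by apply: term_add Sb'; apply: term_mul Sa'; apply: term_scalar.
  rewrite mulr_algl; apply: le_lt_trans (rank_distD rkP _ _ _ _) _.
  rewrite -scalerBr -mulr_algl.
  have := rank_mull rkP c%:A (a - a'); lra.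
- apply/term_closureP => e e0; have e20 : 0 < e / 2 by rewrite divr_gt0.
  have [a' Sa' aa'] := aP _ e20; have [b' Sb' bb'] := bP _ e20.
  exists (a' * b'); first exact: term_mul.
  apply: le_lt_trans (rank_distM rkP _ _ _ _) _; lra.
Qed.

Lemma term_closure_limit (u : nat -> A) l : (forall n, u n \in term_closure) ->
  (forall e, 0 < e -> exists N, forall n, (N <= n)%N -> rk (u n - l) < e) ->
  l \in term_closure.
Proof.
move=> uS ul; apply/term_closureP => e e0.
have e20 : 0 < e / 2 by rewrite divr_gt0.
have [N /(_ N (leqnn N)) uN] := ul _ e20.
have [b Sb ub] := term_closureP _ (uS N) _ e20.
exists b => //; apply: le_lt_trans (rank_triangle rkP (u N) _ _) _.
rewrite [X in X + _](rank_distC rkP); lra.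
Qed.

(** If z is an inner inverse of the defect c = (1 - b x) b = b (1 - x b) then
    b (x + (1 - x b) z (1 - b x)) b = b x b + c z c = b.  Taking z = q c q with
    q an inner inverse of c bounds the rank of the correction by that of c. *)
Definition correct_qinv (x b : A) : A :=
  let c := b - b * x * b in
  x + (1 - x * b) * (qinv c * c * qinv c) * (1 - b * x).

Lemma correct_qinvP x b : b * correct_qinv x b * b = b.
Proof.
rewrite /correct_qinv; set c := b - b * x * b.
have cl : b * (1 - x * b) = c by rewrite mulrBr mulr1 mulrA.
have cr : (1 - b * x) * b = c by rewrite mulrBl mul1r.
rewrite mulrDr mulrDl !mulrA cl -[_ * (1 - b * x) * b]mulrA cr.
by rewrite -!mulrA [qinv c * (c * _)]mulrA !mulrA !qinvP addrC subrK.
Qed.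

(** When a x a = a the defect of x at b is (b - a) - (b x b - a x a), and b x b
    differs from a x a in two factors, by b - a each time. *)
Lemma correct_qinv_dist a x b : a * x * a = a ->
  rk (correct_qinv x b - x) <= 3 * rk (b - a).
Proof.
move=> axa; rewrite /correct_qinv; set c := b - b * x * b.
rewrite addrC addKr.
apply: le_trans (rank_mulr rkP _ _) _; apply: le_trans (rank_mull rkP _ _) _.
apply: le_trans (rank_mulr rkP _ _) _; apply: le_trans (rank_mull rkP _ _) _.
have -> : c = (b - a) - (b * x * b - a * x * a).
  by rewrite axa opprB addrA subrK.
apply: le_trans (rank_add rkP _ _) _; rewrite rank_opp //.
have h1 := rank_distM rkP (b * x) b (a * x) a.
have := rank_distM rkP b x a x; rewrite subrr (rank_zero rkP) // => h2.
lra.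
Qed.

Lemma term_correct_qinv x b : S x -> S b -> S (correct_qinv x b).
Proof.
move=> Sx Sb; have S1 := term_one; rewrite /correct_qinv.
by repeat (apply: term_sub || apply: term_add || apply: term_mul ||
           apply: term_qinv).
Qed.

(** Approximate a by terms s n, and correct an inner inverse of s n into one of
    s n.+1.  The inner inverses obtained are terms and form a Cauchy sequence,
    whose limit is an inner inverse of a. *)
Lemma term_closure_regular a : a \in term_closure ->
  exists2 x, x \in term_closure & a * x * a = a.
Proof.
move=> /term_closureP aP.
(* The factor 6 gives 3 (rk (a - s j) + rk (a - s j.+1)) <= 2^-j, the bound
   on the distance between consecutive inner inverses. *)
have e0 j : 0 < 2^-1 ^+ j / 6 :> R by rewrite divr_gt0 // exprn_gt0 // invr_gt0.
have ex_s j : exists s, S s /\ rk (a - s) < 2^-1 ^+ j / 6.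
  by have [b Sb ab] := aP _ (e0 j); exists b.
have [s sP] := choice ex_s.
pose x := fix x n :=
  if n is m.+1 then correct_qinv (x m) (s m.+1) else qinv (s 0%N).
have sxs n : s n * x n * s n = s n.
  by case: n => [|n] /=; rewrite ?correct_qinvP.
have Sx n : S (x n).
  elim: n => [|n IH] /=; first exact: term_qinv (sP _).1.
  exact: term_correct_qinv IH (sP _).1.
have [l lP] : exists l, forall e, 0 < e ->
    exists N, forall n, (N <= n)%N -> rk (x n - l) < e.
  apply: fast_cauchy_limit (cont_complete contA) _ => // j /=.
  apply: le_trans (correct_qinv_dist _ (sxs j)) _.
  have := rank_triangle rkP a (s j.+1) (s j).
  rewrite [X in _ <= X + _](rank_distC rkP).
  have := (sP j).2; have := (sP j.+1).2; rewrite exprS.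
  have := e0 j; lra.
exists l; first by apply: term_closure_limit lP => n; apply: term_closure_term.
apply: (rank_small_eq rkP) => e egt0.
have e50 : 0 < e / 5 by rewrite divr_gt0.
have [N1 N1P] := lP _ e50; have [N2 N2P] := geometric_lt e50.
pose n := maxn N1 N2.
have := N1P n (leq_maxl _ _); have := N2P n (leq_maxr _ _); have := (sP n).2.
rewrite (rank_distC rkP (x n)) => h1 h2 h3.
apply: le_lt_trans (rank_triangle rkP (s n) _ _) _.
rewrite -{1}(sxs n) (rank_distC rkP (s n) a).
have h4 := rank_distM rkP (a * l) a (s n * x n) (s n).
have h5 := rank_distM rkP a l (s n) (x n).
have := e0 n; lra.
Qed.

HB.instance Definition _ :=
  GRing.isSubalgClosed.Build K A term_closure term_closure_subalg.

Record subalgebra :=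
  Subalgebra { subalgebra_val : A; _ : subalgebra_val \in term_closure }.
HB.instance Definition _ := [isSub for subalgebra_val].
HB.instance Definition _ := [Choice of subalgebra by <:].
HB.instance Definition _ := [SubChoice_isSubAlgebra of subalgebra by <:].

HB.instance Definition _ :=
  GRing.RMorphism.copy subalgebra_val (\val : subalgebra -> A).
HB.instance Definition _ :=
  GRing.Linear.copy subalgebra_val (\val : subalgebra -> A).

(** A downward Loewenheim-Skolem theorem for continuous algebras. *)
Lemma countable_subalgebra :
  exists (B : algType K) (iota : {lrmorphism B -> A}),
    [/\ injective iota, forall x, exists b, iota b = gen x,
        continuous_algebra (rk \o iota) & rank_separable (rk \o iota)].
Proof.
exists subalgebra, subalgebra_val; split=> /=.
- exact: val_inj.
- by move=> x; exists (Subalgebra (term_closure_term (term_gen x))).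
- split.
  + move=> a; have [x xS axa] := term_closure_regular (valP a).
    by exists (Subalgebra xS); apply: val_inj; rewrite !rmorphM.
  + split=> [a|a|||a b|e f ee ff ef fe] /=.
    * exact: rank_itv rkP _.
    * split=> [/(rank_eq0 rkP) a0|->]; last by rewrite raddf0 rank_zero.
      by apply: val_inj; rewrite [LHS]a0 raddf0.
    * exact: rank_1 rkP.
    * by move=> a b; apply: rank_add.
    * exact: rank_mul.
    * by apply: (rank_idem rkP); [have := congr1 val ee|have := congr1 val ff
                                 |have := congr1 val ef|have := congr1 val fe].
  + move=> u cauchy.
    have [|l lP] := cont_complete contA (u := fun n => val (u n)).
      move=> e /cauchy[N NP]; exists N => m n le_m le_n.
      by rewrite -raddfB; apply: NP.
    have lS : l \in term_closure.
      by apply: term_closure_limit lP => n; apply: valP.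
    by exists (Subalgebra lS) => e /lP[N NP]; exists N => n /NP.
- exists (val @^-1` S); split.
    apply: sub_countable term_countable; apply: card_ge_preimage.
    by move=> ? ? _ _; apply: val_inj.
  move=> a e e0; have [b Sb ab] := term_closureP _ (valP a) e e0.
  by exists (Subalgebra (term_closure_term Sb)).
Qed.

End CountableSubalgebra.

(** * Limits along an ultrafilter *)

Section UltraLimit.
Variables (R : realType) (U : set_system nat).
Hypothesis U_ultra : UltraFilter U.

Lemma ultra_cvg (f : nat -> R) (a b : R) :
  (forall k, a <= f k <= b) -> cvg (f @ U).
Proof.
move=> fab; have fU : (f @ U) `[a, b]%classic.
  by apply: (@filterE _ U) => k; rewrite /= in_itv; apply: fab.
(* A cluster point of an ultrafilter is a limit of it. *)
have [p [_ pU]] := @segment_compact R a b _ _ fU.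
apply/cvg_ex; exists p => V Vp.
have [//|nV] := in_ultra_setVsetC (f @^-1` V) U_ultra.
by have [x []] := pU (~` V) V nV Vp.
Qed.

Lemma cvg_null_sum I (s : seq I) (F : I -> nat -> R) :
    (forall i, F i @ U --> (0 : R)) ->
  (fun k => \sum_(i <- s) F i k) @ U --> (0 : R).
Proof.
move=> F0; elim: s => [|i s IH].
  rewrite (_ : (fun _ => _) = cst 0); first exact: cvg_cst.
  by apply/funext => k; rewrite big_nil.
rewrite (_ : (fun _ => _) = F i \+ (fun k => \sum_(j <- s) F j k)).
  by rewrite -[0 in X in _ --> X]addr0; apply: cvgD.
by apply/funext => k; rewrite big_cons.
Qed.

Lemma cvg_null_le (f g : nat -> R) :
  (forall k, 0 <= f k <= g k) -> g @ U --> (0 : R) -> f @ U --> (0 : R).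
Proof.
move=> fg g0; apply: squeeze_cvgr (cvg_cst 0) g0.
by apply: filterE => k; apply: fg.
Qed.

End UltraLimit.

(** * Metric ultraproducts *)

Section Ultraproduct.
Variables (R : realType) (K : fieldType) (A : nat -> algType K).
Variable rho : forall k n, 'M[A k]_n -> R.
Hypothesis rhoP : forall k, sylvester_rank (@rho k).
Hypothesis A_regular : forall k, von_neumann_regular (A k).
Variable U : set_system nat.
Hypothesis U_ultra : UltraFilter U.
Hypothesis U_free : \oo `<=` U.

Local Notation family := (forall k, A k).

(** Matrices over the ultraproduct are first handled as families of matrices,
    so that no ring structure on the product of the A k is needed. *)
Definition urank n (X : forall k, 'M[A k]_n) : R :=
  lim ((fun k => rho (X k)) @ U).

Lemma urank_cvg n (X : forall k, 'M[A k]_n) :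
  (fun k => rho (X k)) @ U --> urank X.
Proof.
apply: (@ultra_cvg _ _ U_ultra _ 0 n%:R) => k.
by rewrite (syl_ge0 (rhoP k)) (syl_le (rhoP k)).
Qed.

Lemma urank_le n m (X : forall k, 'M[A k]_n) (Y : forall k, 'M[A k]_m) :
  (forall k, rho (X k) <= rho (Y k)) -> urank X <= urank Y.
Proof.
move=> XY; apply: ler_lim; [exact: urank_cvg|exact: urank_cvg|].
by apply: filterE => k; apply: XY.
Qed.

Definition scalar_rank k (a : A k) : R := rho (a%:M : 'M_1).

Definition ultra_equiv (a b : family) : bool :=
  `[< (fun k => scalar_rank (a k - b k)) @ U --> (0 : R) >].

Lemma scalar_rank_ge0 k (a : A k) : 0 <= scalar_rank a.
Proof. exact: syl_ge0. Qed.

Lemma scalar_rankD k (a b : A k) :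
  scalar_rank (a + b) <= scalar_rank a + scalar_rank b.
Proof. by rewrite /scalar_rank raddfD; apply: sylD. Qed.

Lemma scalar_rankN k (a : A k) : scalar_rank (- a) = scalar_rank a.
Proof. by rewrite /scalar_rank raddfN sylN. Qed.

Lemma scalar_rank_mulr k (a b : A k) : scalar_rank (a * b) <= scalar_rank a.
Proof. by rewrite /scalar_rank scalar_mxM syl_mulr. Qed.

Lemma scalar_rank_mull k (a b : A k) : scalar_rank (a * b) <= scalar_rank b.
Proof. by rewrite /scalar_rank scalar_mxM syl_mull. Qed.

Lemma scalar_rank0 k : scalar_rank (0 : A k) = 0.
Proof. by rewrite /scalar_rank raddf0 (syl0 (rhoP k)). Qed.

Lemma ultra_equiv_le1 (a a' b b' : family) :
    (forall k, scalar_rank (b k - b' k) <= scalar_rank (a k - a' k)) ->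
  ultra_equiv a a' -> ultra_equiv b b'.
Proof.
move=> le_ba /asboolP aa'; apply/asboolP; apply: cvg_null_le aa' => k.
by rewrite scalar_rank_ge0 le_ba.
Qed.

Lemma ultra_equiv_le2 (a a' b b' c c' : family) :
    (forall k, scalar_rank (c k - c' k) <=
      scalar_rank (a k - a' k) + scalar_rank (b k - b' k)) ->
  ultra_equiv a a' -> ultra_equiv b b' -> ultra_equiv c c'.
Proof.
move=> le_c /asboolP aa' /asboolP bb'; apply/asboolP.
apply: cvg_null_le (_ : _ \+ _ @ U --> _) => [k|].
  by rewrite scalar_rank_ge0; apply: le_c.
by rewrite -[0 in X in _ --> X]addr0; apply: cvgD.
Qed.

Lemma ultra_equiv_refl : reflexive ultra_equiv.
Proof.
move=> a; apply/asboolP; rewrite (_ : (fun _ => _) = cst 0).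
  exact: cvg_cst.
by apply/funext => k; rewrite subrr scalar_rank0.
Qed.

Lemma ultra_equiv_sym : symmetric ultra_equiv.
Proof.
have le_sym a b : ultra_equiv a b -> ultra_equiv b a.
  by apply: ultra_equiv_le1 => k; rewrite -scalar_rankN opprB.
by move=> a b; apply/idP/idP; apply: le_sym.
Qed.

Lemma ultra_equiv_trans : transitive ultra_equiv.
Proof.
move=> b a c; apply: ultra_equiv_le2 => k.
by apply: le_trans (scalar_rankD _ _); rewrite addrA subrK.
Qed.

Canonical ultra_equiv_equiv :=
  EquivRel ultra_equiv ultra_equiv_refl ultra_equiv_sym ultra_equiv_trans.

Definition ultraproduct := {eq_quot ultra_equiv}.
HB.instance Definition _ : EqQuotient _ ultra_equiv ultraproduct :=
  EqQuotient.on ultraproduct.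
HB.instance Definition _ := Choice.on ultraproduct.

Definition upi (a : family) : ultraproduct := \pi a.
Definition urepr (x : ultraproduct) : family := repr x.

Lemma ureprK : cancel urepr upi. Proof. exact: reprK. Qed.

Lemma upiP a b : reflect (upi a = upi b) (ultra_equiv a b).
Proof. by apply: (iffP idP) => [/eqmodP|/eqmodP]. Qed.

Lemma urepr_upi a : ultra_equiv (urepr (upi a)) a.
Proof. by apply/upiP; rewrite ureprK. Qed.

Definition uadd x y := upi (fun k => urepr x k + urepr y k).
Definition uopp x := upi (fun k => - urepr x k).
Definition umul x y := upi (fun k => urepr x k * urepr y k).
Definition uscale (c : K) x := upi (fun k => c *: urepr x k).

Lemma uaddE a b : uadd (upi a) (upi b) = upi (fun k => a k + b k).
Proof.
apply/upiP; apply: ultra_equiv_le2 (urepr_upi a) (urepr_upi b) => k.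
by apply: le_trans (scalar_rankD _ _); rewrite opprD addrACA.
Qed.

Lemma uoppE a : uopp (upi a) = upi (fun k => - a k).
Proof.
apply/upiP; apply: ultra_equiv_le1 (urepr_upi a) => k.
by rewrite -opprD scalar_rankN.
Qed.

Lemma umulE a b : umul (upi a) (upi b) = upi (fun k => a k * b k).
Proof.
apply/upiP; apply: ultra_equiv_le2 (urepr_upi a) (urepr_upi b) => k.
set a' := urepr _ k; set b' := urepr _ k.
have -> : a' * b' - a k * b k = (a' - a k) * b' + a k * (b' - b k).
  by rewrite mulrBl mulrBr addrA subrK.
apply: le_trans (scalar_rankD _ _) _.
by rewrite lerD ?scalar_rank_mulr ?scalar_rank_mull.
Qed.

Lemma uscaleE c a : uscale c (upi a) = upi (fun k => c *: a k).
Proof.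
apply/upiP; apply: ultra_equiv_le1 (urepr_upi a) => k.
by rewrite -scalerBr -mulr_algl scalar_rank_mull.
Qed.

Let uE := (uaddE, uoppE, umulE, uscaleE).

(* Reduces a law of the ultraproduct to the same law in each factor. *)
Ltac ualg := repeat (let x := fresh in move=> x; try rewrite -(ureprK x));
  rewrite ?uE; congr upi; apply: functional_extensionality_dep => k.

Definition uzero := upi (fun k => 0).
Definition uone := upi (fun k => 1).

Lemma uaddA : associative uadd.
Proof. by ualg; rewrite addrA. Qed.
Lemma uaddC : commutative uadd.
Proof. by ualg; rewrite addrC. Qed.
Lemma uadd0 : left_id uzero uadd.
Proof. by rewrite /uzero; ualg; rewrite add0r. Qed.
Lemma uaddN : left_inverse uzero uopp uadd.
Proof. by rewrite /uzero; ualg; rewrite addNr. Qed.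

HB.instance Definition _ :=
  GRing.isZmodule.Build ultraproduct uaddA uaddC uadd0 uaddN.

Lemma umulA : associative umul.
Proof. by ualg; rewrite mulrA. Qed.
Lemma umul1 : left_id uone umul.
Proof. by rewrite /uone; ualg; rewrite mul1r. Qed.
Lemma umulr1 : right_id uone umul.
Proof. by rewrite /uone; ualg; rewrite mulr1. Qed.
Lemma umulDl : left_distributive umul uadd.
Proof. by ualg; rewrite mulrDl. Qed.
Lemma umulDr : right_distributive umul uadd.
Proof. by ualg; rewrite mulrDr. Qed.

Lemma uone_neq0 : uone != uzero.
Proof.
apply/eqP => /upiP/asboolP.
rewrite (_ : (fun _ => _) = cst 1); last first.
  by apply/funext => k; rewrite subr0 /scalar_rank (syl1 (rhoP k)).
move=> /(cvg_lim (@Rhausdorff R)); rewrite lim_cst // => /eqP.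
by rewrite oner_eq0.
Qed.

HB.instance Definition _ := GRing.Zmodule_isNzRing.Build ultraproduct
  umulA umul1 umulr1 umulDl umulDr uone_neq0.

Lemma uscaleA c c' x : uscale c (uscale c' x) = uscale (c * c') x.
Proof. by move: x; ualg; rewrite scalerA. Qed.
Lemma uscale1 : left_id 1 uscale.
Proof. by ualg; rewrite scale1r. Qed.
Lemma uscaleDr : right_distributive uscale uadd.
Proof. by move=> c; ualg; rewrite scalerDr. Qed.
Lemma uscaleDl x : {morph uscale^~ x : c c' / c + c' >-> uadd c c'}.
Proof. by move=> c c'; move: x; ualg; rewrite scalerDl. Qed.

HB.instance Definition _ := GRing.Zmodule_isLmodule.Build K ultraproduct
  uscaleA uscale1 uscaleDr uscaleDl.

Lemma uscaleAl c x y : uscale c (umul x y) = umul (uscale c x) y.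
Proof. by move: x y; ualg; rewrite scalerAl. Qed.
Lemma uscaleAr c x y : uscale c (umul x y) = umul x (uscale c y).
Proof. by move: x y; ualg; rewrite scalerAr. Qed.

HB.instance Definition _ :=
  GRing.Lmodule_isLalgebra.Build K ultraproduct uscaleAl.
HB.instance Definition _ :=
  GRing.Lalgebra_isAlgebra.Build K ultraproduct uscaleAr.

Lemma upiD a b : upi (fun k => a k + b k) = upi a + upi b.
Proof. by rewrite -uaddE. Qed.
Lemma upiN a : upi (fun k => - a k) = - upi a.
Proof. by rewrite -uoppE. Qed.
Lemma upiM a b : upi (fun k => a k * b k) = upi a * upi b.
Proof. by rewrite -umulE. Qed.
Lemma upiZ c a : upi (fun k => c *: a k) = c *: upi a.
Proof. by rewrite -uscaleE. Qed.
Lemma upi0 : upi (fun k => 0) = 0. Proof. by []. Qed.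
Lemma upi1 : upi (fun k => 1) = 1. Proof. by []. Qed.

Lemma upi_sum I (s : seq I) (F : I -> family) :
  upi (fun k => \sum_(i <- s) F i k) = \sum_(i <- s) upi (F i).
Proof.
elim: s => [|i s IH].
  rewrite big_nil -upi0; congr upi; apply: functional_extensionality_dep => k.
  by rewrite big_nil.
rewrite big_cons -IH -upiD; congr upi.
by apply: functional_extensionality_dep => k; rewrite big_cons.
Qed.

Lemma ultraproduct_regular : von_neumann_regular ultraproduct.
Proof.
move=> x; rewrite -(ureprK x); move: (urepr x) => a.
pose q k := cid (A_regular (a k)); exists (upi (fun k => sval (q k))).
rewrite -(upiM a) -upiM; congr upi.
by apply: functional_extensionality_dep => k; apply: (svalP (q k)).
Qed.

Definition umx n (X : forall k, 'M[A k]_n) : 'M[ultraproduct]_n :=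
  \matrix_(i, j) upi (fun k => X k i j).

Definition mxrepr n (B : 'M[ultraproduct]_n) k : 'M[A k]_n :=
  \matrix_(i, j) urepr (B i j) k.

Definition ultra_rank n (B : 'M[ultraproduct]_n) : R := urank (mxrepr B).

Lemma mxreprK n (B : 'M[ultraproduct]_n) : umx (mxrepr B) = B.
Proof.
apply/matrixP => i j; rewrite mxE -[RHS]ureprK; congr upi.
by apply: functional_extensionality_dep => k; rewrite mxE.
Qed.

(** Equivalent families of entries give the same limit rank: the rank of X k is
    at most that of Y k plus the ranks of the finitely many entries of
    X k - Y k, each of which tends to 0. *)
Lemma urank_umx_le n (X Y : forall k, 'M[A k]_n) :
  umx X = umx Y -> urank X <= urank Y.
Proof.
move=> /matrixP eqXY.
pose D k : R := \sum_i \sum_j scalar_rank (X k i j - Y k i j).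
have D0 : D @ U --> (0 : R).
  apply: cvg_null_sum => i; apply: cvg_null_sum => j.
  by apply/asboolP/upiP; have := eqXY i j; rewrite !mxE.
have YD : (fun k => rho (Y k)) \+ D @ U --> urank Y + 0.
  by apply: cvgD D0; apply: urank_cvg.
rewrite -[leRHS]addr0 -(cvg_lim _ YD) //.
apply: ler_lim; [exact: urank_cvg|by apply/cvg_ex; eexists; exact: YD|].
apply: filterE => k /=.
rewrite -{1}[X k](subrK (Y k)) addrC; apply: le_trans (sylD (rhoP k) _ _) _.
rewrite lerD2l; apply: le_trans (syl_le_entries (rhoP k) _) _.
by apply: ler_sum => i _; apply: ler_sum => j _; rewrite /scalar_rank !mxE.
Qed.

Lemma ultra_rankE n (X : forall k, 'M[A k]_n) : ultra_rank (umx X) = urank X.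
Proof. by apply/le_anti; rewrite !urank_umx_le // mxreprK. Qed.

Lemma ultra_rank_cvg n (X : forall k, 'M[A k]_n) :
  (fun k => rho (X k)) @ U --> ultra_rank (umx X).
Proof. by rewrite ultra_rankE; apply: urank_cvg. Qed.

Lemma umxM n (X Y : forall k, 'M[A k]_n) :
  umx (fun k => X k *m Y k) = umx X *m umx Y.
Proof.
apply/matrixP => i j; rewrite !mxE.
under eq_bigr do rewrite !mxE -upiM.
rewrite -upi_sum; congr upi; apply: functional_extensionality_dep => k.
by rewrite mxE.
Qed.

Lemma umx0 n : umx (fun k => 0 : 'M[A k]_n) = 0.
Proof.
apply/matrixP => i j; rewrite !mxE -upi0; congr upi.
by apply: functional_extensionality_dep => k; rewrite mxE.
Qed.

Lemma umx_scalar n a : umx (fun k => (a k)%:M : 'M[A k]_n) = (upi a)%:M.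
Proof.
apply/matrixP => i j; rewrite !mxE.
by case: eqP => ij; rewrite ?mulr1n ?mulr0n -?upi0; congr upi;
  apply: functional_extensionality_dep => k; rewrite mxE;
  case: eqP ij => // _ _; rewrite ?mulr1n ?mulr0n.
Qed.

Lemma umx_block m n (X : forall k, 'M[A k]_m) (Y : forall k, 'M[A k]_n) :
  umx (fun k => block_mx (X k) 0 0 (Y k)) = block_mx (umx X) 0 0 (umx Y).
Proof.
apply/matrixP => i j; rewrite mxE -[i]splitK -[j]splitK.
by case: (fintype.split i) => i'; case: (fintype.split j) => j' /=;
  rewrite ?(block_mxEul, block_mxEur, block_mxEdl, block_mxEdr) !mxE -?upi0;
  congr upi; apply: functional_extensionality_dep => k;
  rewrite ?(block_mxEul, block_mxEur, block_mxEdl, block_mxEdr) ?mxE.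
Qed.

Lemma ultra_rank_sylvester : sylvester_rank ultra_rank.
Proof.
split=> [n|n|n B C|k l B C].
- rewrite -upi1 -umx_scalar ultra_rankE /urank.
  rewrite (_ : (fun _ => _) = cst n%:R) ?lim_cst //.
  by apply/funext => k; rewrite (syl1 (rhoP k)).
- rewrite -umx0 ultra_rankE /urank (_ : (fun _ => _) = cst 0) ?lim_cst //.
  by apply/funext => k; rewrite (syl0 (rhoP k)).
- rewrite -(mxreprK B) -(mxreprK C) -umxM !ultra_rankE le_min.
  by rewrite !urank_le // => k; [apply: syl_mull|apply: syl_mulr].
- rewrite -(mxreprK B) -(mxreprK C) -umx_block !ultra_rankE.
  rewrite /urank -limD; try exact: urank_cvg.
  congr (lim (_ @ U)); apply/funext => i /=; exact: (syl_block (rhoP i)).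
Qed.

Lemma ultra_rank_faithful x : ultra_rank (x%:M : 'M_1) = 0 -> x = 0.
Proof.
rewrite -[x]ureprK -umx_scalar -upi0 => r0; apply/upiP/asboolP.
under eq_fun do rewrite subr0.
by rewrite -r0; apply: ultra_rank_cvg.
Qed.

Let rk (x : ultraproduct) := ultra_rank (x%:M : 'M_1).

Lemma rk_cvg a : (fun k => scalar_rank (a k)) @ U --> rk (upi a).
Proof. by rewrite /rk -umx_scalar; apply: ultra_rank_cvg. Qed.

(** Given representatives v j of a fast Cauchy sequence, the step from v j to
    v j.+1 is small on a set close j of U.  The limit adds up, in coordinate k,
    the steps with j < k for which k lies in close j.  For U-almost all k the
    steps with j < i are all present, so the limit differs from v i by a tail
    of small steps. *)
Lemma ultraproduct_complete : rank_complete rk.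
Proof.
apply: complete_of_fast_limits => [|w fast].
  exact: scalar_rank_function ultra_rank_sylvester ultra_rank_faithful.
pose v j : family := urepr (w j).
pose close j : set nat := [set k | scalar_rank (v j.+1 k - v j k) < 2^-1 ^+ j].
have U_close j : U (close j).
  have := @rk_cvg (fun k => v j.+1 k - v j k).
  rewrite upiD upiN !ureprK => wj_cvg; exact: cvgr_lt wj_cvg _ (fast j).
pose l : family := fun k =>
  v 0%N k + \sum_(0 <= j < k | `[< close j k >]) (v j.+1 k - v j k).
exists (upi l) => i; rewrite -(ureprK (w i)) -upiN -upiD.
have U_good : U [set k | (i <= k)%N /\ forall j, (j < i)%N -> close j k].
  apply: filterI; first by apply: U_free; exists i.
  elim: (i) => [|n IH]; first exact: filterE.
  by near=> k; rewrite /= => j; rewrite ltnS leq_eqVlt => /predU1P[->|];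
    [near: k; apply: U_close|move: j; near: k].
rewrite -(cvg_lim _ (@rk_cvg (fun k => v i k - l k))) //.
apply: limr_le; first by apply/cvg_ex; eexists; apply: rk_cvg.
apply: filterS U_good => k [le_ik ck].
have -> : v i k - l k =
    - \sum_(i <= j < k | `[< close j k >]) (v j.+1 k - v j k).
  rewrite /l (big_cat_nat _ le_ik) //=.
  rewrite [X in _ + (X + _)](_ : _ = v i k - v 0%N k).
    by rewrite addrA [v 0%N k + _]addrC subrK opprD addrA subrr add0r.
  rewrite -(telescope_sumr (fun j => v j k)) //.
  rewrite [LHS]big_nat_cond [RHS]big_nat_cond.
  apply: eq_bigl => j; rewrite andbT; case: (ltnP j i) => //= ji.
  exact/asboolP/ck.
rewrite scalar_rankN /scalar_rank raddf_sum.
apply: le_trans (syl_sum (rhoP k) _ _ _) _.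
apply: le_trans _ (sum_geometric_tail R le_ik).
rewrite [leLHS]big_mkcond; apply: ler_sum => j _.
by case: asboolP => [/ltW//|_]; rewrite exprn_ge0 // invr_ge0.
Unshelve. all: by end_near.
Qed.

End Ultraproduct.

(** * The limit representation *)

Lemma sylvester_pullback (R : realType) (A B : pzRingType)
    (iota : {rmorphism B -> A}) (rho : forall n, 'M[A]_n -> R) :
  sylvester_rank rho ->
  sylvester_rank (fun n (M : 'M[B]_n) => rho n (map_mx iota M)).
Proof.
move=> rhoP; split=> [n|n|n M N|k l M N].
- by rewrite map_mx1 (syl1 rhoP).
- by rewrite map_mx0 (syl0 rhoP).
- by rewrite map_mxM (sylM rhoP).
- by rewrite map_block_mx !map_mx0 (syl_block rhoP).
Qed.

Lemma representation1 (G : groupType) (A : pzRingType) (theta : G -> A) :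
  is_representation theta -> theta 1%g = 1.
Proof.
move=> [inv morph]; have [b [_ b1]] := inv 1%g.
by rewrite -[LHS]mul1r -b1 -mulrA -morph mulg1.
Qed.

Lemma is_representation_of_morph (G : groupType) (A : pzRingType)
    (theta : G -> A) :
  theta 1%g = 1 -> {morph theta : g h / (g * h)%g >-> g * h} ->
  is_representation theta.
Proof.
move=> th1 morph; split=> // g; exists (theta g^-1%g).
by rewrite -!morph mulgV mulVg th1.
Qed.

HB.instance Definition _ r := [Countable of free_group r by <:].

Theorem theorem1 (R : realType) (K : finFieldType) (r : nat) (d : nat -> nat)
    (d_gt0 : forall k, (0 < d k)%N)
    (theta_ : forall k, free_group r -> 'M[K]_(d k))
    (theta_rep : forall k, is_representation (theta_ k))
    (theta_cvg : convergent R theta_) :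
  exists (A : algType K) (rk : A -> R) (theta : free_group r -> A),
    [/\ continuous_algebra rk, rank_separable rk,
        is_representation theta & is_limit theta_ rk theta].
Proof.
(* An algType is a nonzero ring, and a ring of square matrices is one
   canonically only when its size is written as a successor. *)
have [d' dE] : exists d', d = (fun k => (d' k).+1).
  by exists (fun k => (d k).-1); apply/funext => k; rewrite prednK.
subst d => {d_gt0}.
have [U [U_ultra U_free]] := @ultraFilterLemma nat \oo _.
pose A k : algType K := 'M[K]_((d' k).+1).
pose rho k n (B : 'M[A k]_n) : R := (\rank (flatten_mx B))%:R / (d' k).+1%:R.
have rhoP k : sylvester_rank (@rho k) by apply: matrix_sylvester.
have A_regular k : von_neumann_regular (A k) by apply: matrix_regular.
pose Q := ultraproduct rhoP U_ultra.
pose rkM n (B : 'M[Q]_n) : R := ultra_rank B.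
have rkMP : sylvester_rank rkM by apply: ultra_rank_sylvester.
have faithful x : rkM 1%N x%:M = 0 -> x = 0 by apply: ultra_rank_faithful.
have contQ : continuous_algebra (fun x : Q => rkM 1%N x%:M).
  split; first exact: ultraproduct_regular.
    exact: scalar_rank_function.
  exact: ultraproduct_complete.
pose gen g : Q := upi rhoP U_ultra (fun k => theta_ k g).
have [B [iota [inj_iota iota_gen contB sepB]]] :=
  countable_subalgebra contQ gen.
have [theta thetaE] := choice iota_gen.
exists B, ((fun x : Q => rkM 1%N x%:M) \o iota), theta; split=> //.
- apply: is_representation_of_morph => [|g h]; apply: inj_iota.
    rewrite thetaE rmorph1; congr upi.
    apply: functional_extensionality_dep => k.
    exact: representation1 (theta_rep k).
  rewrite rmorphM /= !thetaE -upiM; congr upi.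
  by apply: functional_extensionality_dep => k; apply: (theta_rep k).2.
have syl := sylvester_pullback iota rkMP.
exists (fun n (M : 'M[B]_n) => rkM n (map_mx iota M)).
  have rkE : (fun x : Q => rkM 1%N x%:M) \o iota =
      (fun b => rkM 1%N (map_mx iota (b%:M : 'M_1))).
    by apply/funext => b; rewrite /= map_scalar_mx.
  rewrite rkE; apply: syl_matrix_rank syl _ => b.
  by rewrite map_scalar_mx => /faithful b0; apply: inj_iota; rewrite b0 raddf0.
move=> n M n_gt0; pose X k := map_mx (lin_ext (theta_ k)) M.
have -> : map_mx iota (map_mx (lin_ext theta) M) = umx rhoP U_ultra X.
  apply/matrixP => i j; rewrite !mxE raddf_sum /=.
  under eq_bigr do rewrite linearZ /= thetaE -upiZ.
  rewrite -upi_sum; congr upi.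
  by apply: functional_extensionality_dep => k; rewrite mxE.
(* Both limits of the sequence of ranks, along U and along the integers, exist,
   and U refines the latter filter. *)
have X_U := @ultra_rank_cvg _ _ _ _ rhoP _ U_ultra n X.
have X_oo := theta_cvg n M n_gt0.
have <- : lim (fd_rank R (theta_ k) M @[k --> \oo]) =
    rkM n (umx rhoP U_ultra X).
  by apply: (cvg_unique _ _ X_U) => //; apply: cvg_trans X_oo; apply: cvg_app.
exact: X_oo.
Qed.
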